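(* Let $k \geq 2$ be an integer and let $p_1, \ldots, p_{k-1}$ be pairwise distinct prime numbers. Then there exists a partition $A_1, \ldots, A_k$ of $\mathbb{N}$ such that, for each $i = 1, \ldots, k-1$, none of the sets $A_1, \ldots, A_k$ is dense in $\mathbb{Z}_{p_i}$.
   Context: $\mathbb{N}$ denotes the set of positive integers, viewed as a subset of $\mathbb{Z}_p$ with the $p$-adic topology. *)

(* Defs.v *)
From mathcomp Require Import all_boot.
From mathcomp Require Import boolp classical_sets topology.

Set Implicit Arguments.
Unset Strict Implicit.
Unset Printing Implicit Defensive.

Local Open Scope classical_set_scope.

(* Z_p is the inverse limit of the discrete spaces Z/p^m, with the subspace
   topology of the product: an element is its sequence of residues modulo p^m,
   m >= 0. It is only meaningful for p > 0 (for p = 0 it is empty). *)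
Notation residue_seq p :=
  (prod_topology (fun m : nat => discrete_topology 'I_(p ^ m))).

Definition padic_int (p : nat) : set (residue_seq p) :=
  [set x | forall m : nat, (x m.+1 : 'I__) = (x m : 'I__) %[mod p ^ m]].
Arguments padic_int p _ : clear implicits.

Lemma ltn_pmod_expn (p : nat) (p_pr : prime p) (n m : nat) :
  n %% p ^ m < p ^ m.
Proof. by rewrite ltn_mod expn_gt0 prime_gt0. Qed.

Definition nat_residue_seq (p : nat) (p_pr : prime p) (n : nat) :
  residue_seq p := fun m => Ordinal (ltn_pmod_expn p_pr n m).

Lemma nat_residue_seqP (p : nat) (p_pr : prime p) (n : nat) :
  nat_residue_seq p_pr n \in padic_int p.
Proof.
by apply/mem_set => m /=; rewrite modn_mod modn_dvdm // dvdn_exp2l.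
Qed.

(* The canonical embedding of nat into Z_p, n |-> (n mod p^m)_m. *)
Definition padic_of_nat (p : nat) (p_pr : prime p) (n : nat) : padic_int p :=
  exist _ (nat_residue_seq p_pr n) (nat_residue_seqP p_pr n).

Lemma padic_of_nat_inj (p : nat) (p_pr : prime p) :
  injective (padic_of_nat p_pr).
Proof.
move=> n1 n2 /(congr1 (fun x : padic_int p => sval x (maxn n1 n2))).
have lt_exp n : n <= maxn n1 n2 -> n < p ^ maxn n1 n2.
  by move=> /leq_ltn_trans; apply; rewrite ltn_expl ?prime_gt1.
by case; rewrite !modn_small ?lt_exp ?leq_maxl ?leq_maxr.
Qed.

(* Main.v *)
(* Give each prime p_i the modulus q_i = p_i^k > k, and let a positive integer n
   take the colour j only if n mod q_i <> j for all i < k-1. Each i forbids at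
   most one of the k colours, so some colour is always allowed, and colour j
   misses the open ball j + q_i Z_{p_i} for every i. No class is empty, because
   colour j is allowed for n = j + 1 <= k < q_i. *)
Require Import Defs.
From mathcomp Require Import all_boot.
From mathcomp Require Import mathcomp_extra boolp classical_sets topology.

Local Open Scope classical_set_scope.

(** Preimage of a subset of a discrete space under the continuous projection to coordinate [m],
    restricted to Z_p. *)
Lemma open_padic_ball (p m c : nat) :
  open [set x : padic_int p | (sval x m : 'I_(p ^ m)) = c :> nat].
Proof.
exists [set x : residue_seq p | (x m : 'I_(p ^ m)) = c :> nat] => //.
pose K (i : nat) : topologicalType := discrete_topology 'I_(p ^ i).
have /continuousP proj_open : continuous (proj m : prod_topology K -> K m).
  exact: proj_continuous.
exact: (proj_open [set r : K m | (r : 'I_(p ^ m)) = c :> nat]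
  (discrete_open _)).
Qed.

(** The open ball of residue [c] modulo p^m contains [c] itself, so a dense set meets it. *)
Lemma dense_padic_residue (p : nat) (p_pr : prime p) (S : set nat) (m c : nat) :
  dense (padic_of_nat p_pr @` S) ->
  exists2 n, S n & n = c %[mod p ^ m].
Proof.
move=> /(_ _ _ (open_padic_ball p m (c %% p ^ m))).
case=> [|x [/= Ux [n Sn nx]]]; first by exists (padic_of_nat p_pr c).
by exists n => //; rewrite -nx in Ux.
Qed.

(** Pigeonhole: if every colour were some [r i], choosing such an [i] would inject k colours into
    k-1 indices. *)
Lemma exists_avoiding_colour (k : nat) (r : 'I_k.-1 -> nat) :
  0 < k -> exists j : 'I_k, forall i, r i <> j.
Proof.
move=> k_gt0; apply: contrapT => /forallNP no_colour.
have /choice[g gE] (j : 'I_k) : exists i, r i = j.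
  by have /existsNP[i /contrapT] := no_colour j; exists i.
have /leq_card : injective g.
  by move=> j1 j2 g12; apply: val_inj; rewrite /= -!gE g12.
by rewrite !card_ord leqNgt ltn_predL k_gt0.
Qed.

Theorem theorem2p2 (k : nat) (k_ge2 : 2 <= k) (p : 'I_k.-1 -> nat)
    (p_prime : forall i : 'I_k.-1, prime (p i)) (p_inj : injective p) :
  exists A : 'I_k -> set nat,
    partition [set: 'I_k] A [set n : nat | 0 < n] /\
    forall (i : 'I_k.-1) (j : 'I_k),
      ~ dense (padic_of_nat (p_prime i) @` A j).
Proof.
have k_gt0 : 0 < k by apply: ltnW.
have k_lt i : k < p i ^ k by rewrite ltn_expl ?prime_gt1.
(* The second clause gives [j.+1] the colour [j], so that no class is empty. *)
have /choice[f fP] n : exists j : 'I_k,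
    (forall i, n %% p i ^ k <> j) /\ (0 < n <= k -> n = j.+1).
  have [/andP[n_gt0 n_le]|n_out] := boolP (0 < n <= k); last first.
    have [j jP] := exists_avoiding_colour _ (fun i => n %% p i ^ k) k_gt0.
    by exists j; split=> //; rewrite (negbTE n_out).
  have n1_lt : n.-1 < k by rewrite prednK.
  exists (Ordinal n1_lt); split=> [i|_] /=; last by rewrite prednK.
  rewrite modn_small ?(leq_ltn_trans n_le) // => /eqP.
  by rewrite gtn_eqF // ltn_predL.
exists (fun j => [set n | 0 < n /\ f n = j]); split; first split.
- apply/seteqP; split=> [n [j _ []]//|n n_gt0].
  by exists (f n).
- by move=> j1 j2 _ _ [n [[_ <-] [_ <-]]].
- move=> j _; exists j.+1; split=> //.
  have [_ /(_ (ltn_ord j))[fj]] := fP j.+1.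
  exact/esym/val_inj.
(* Density would put a member of class [j] in the residue class of [j] modulo p_i^k, which its
   colour avoids. *)
- move=> i j /(dense_padic_residue _ _ _ k j)[n [_ fn]].
  rewrite (modn_small (ltn_trans (ltn_ord j) (k_lt i))) -fn.
  by have [avoids _] := fP n; apply: avoids.
Qed.
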